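(* Let $T\in\mathcal{B}^{0,1}_n(V_n)$ and $s=\mathrm{Re}[s]+\underline{s}\in\rho_S(T)$. Let $S^{-1}(s,T)=-(T^2-2\,\mathrm{Re}[s]\,T+|s|^2\mathcal{I})^{-1}(T-\overline{s}\,\mathcal{I})$ be the $S$-resolvent operator. Then $S^{-1}(s,T)$ satisfies the $S$-resolvent equation $$S^{-1}(s,T)\,s-T\,S^{-1}(s,T)=\mathcal{I}.$$
   Context: $\mathbb{R}_n$ is the real Clifford algebra generated by units $e_1,\dots,e_n$ with $e_ie_j+e_je_i=-2\delta_{ij}$, with basis $e_A=e_{i_1}\cdots e_{i_r}$, $i_1<\dots<i_r$. An element $(s_0,\dots,s_n)\in\mathbb{R}^{n+1}$ is identified with $s=s_0+\underline{s}\in\mathbb{R}_n$, $\underline{s}=\sum_{j=1}^n s_je_j$; $\mathrm{Re}[s]=s_0$, $\overline{s}=s_0-\underline{s}$, $|s|$ is the Euclidean norm. $V$ is a real Banach space. $V_n=V\otimes\mathbb{R}_n$ is the two-sided Banach module over $\mathbb{R}_n$ of elements $v=\sum_A v_Ae_A$ ($v_A\in V$), with $va=\sum_A v_A(e_Aa)$, $av=\sum_A v_A(ae_A)$ and $\|v\|^2_{V_n}=\sum_A\|v_A\|_V^2$. $\mathcal{B}(V)$ is the space of bounded $\mathbb{R}$-linear maps $V\to V$. $\mathcal{B}_n(V_n)$ is the set of operators $T=\sum_A T_Ae_A$, $T_A\in\mathcal{B}(V)$, acting by $T(v)=\sum_{A,B}T_A(v_B)e_Ae_B$ (bounded right-module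 homomorphisms of $V_n$), with $\|T\|^2=\sum_A\|T_A\|^2_{\mathcal{B}(V)}$. $\mathcal{B}^{0,1}_n(V_n)$ is the set of those of the form $T=T_0+\sum_{j=1}^n e_jT_j$ with $T_\mu\in\mathcal{B}(V)$ (not necessarily commuting). $\mathcal{I}$ is the identity; $a\in\mathbb{R}_n$ is regarded as the operator $v\mapsto av$, and $Ta$ denotes the composition $T\circ(a\mathcal{I})$. The $S$-spectrum is $\sigma_S(T)=\{s\in\mathbb{R}^{n+1}: T^2-2\,\mathrm{Re}[s]\,T+|s|^2\mathcal{I}\text{ is not invertible in }\mathcal{B}_n(V_n)\}$, and the $S$-resolvent set is $\rho_S(T)=\mathbb{R}^{n+1}\setminus\sigma_S(T)$. *)

(* Defs.v *)
From HB Require Import structures.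
From mathcomp Require Import all_boot all_order all_algebra.
From mathcomp Require Import all_classical all_reals all_analysis.

Set Implicit Arguments.
Unset Strict Implicit.
Unset Printing Implicit Defensive.

Import Order.TTheory GRing.Theory Num.Theory.
Import numFieldNormedType.Exports.
Local Open Scope ring_scope.

Section Index.
Variable n : nat.
Implicit Types A B C : {set 'I_n}.

Definition symdiff A B : {set 'I_n} := [set i | (i \in A) (+) (i \in B)].

(* Sorting the word e_A e_B moves each e_j (j in B) past every e_i (i in A)
   with i > j, at the cost of a sign each time, and then each pair e_i e_i with
   i in A and in B contributes e_i^2 = -1.  So e_A e_B = (-1)^(swaps A B) e_C
   with C the symmetric difference of A and B. *)
Definition swaps A B : nat := (\sum_(i in A) #|[set j in B | (j <= i)%N]|)%N.

End Index.

(* An element of the Clifford algebra is its family of coordinates on the basis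
   (e_A).  The alias keeps the Clifford product apart from the pointwise product
   that the library puts on finite functions. *)
Definition clifford (R : comNzRingType) (n : nat) : Type :=
  {ffun {set 'I_n} -> R^o}.

HB.instance Definition _ (R : comNzRingType) (n : nat) :=
  GRing.Lmodule.copy (clifford R n) {ffun {set 'I_n} -> R^o}.

Section Clifford.
Variables (R : comNzRingType) (n : nat).
Local Notation Cl := (clifford R n).
Implicit Types (A B C D : {set 'I_n}) (a b c : Cl).

Definition coord a A : R := (a : {ffun {set 'I_n} -> R^o}) A.

Definition basis A : Cl := ([ffun B => (B == A)%:R] : {ffun {set 'I_n} -> R^o}).

Definition clmul a b : Cl :=
  \sum_A \sum_B (coord a A * coord b B * (-1) ^+ swaps A B) *:
    basis (symdiff A B).

Definition gen (i : 'I_n) : Cl := basis [set i].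

Lemma clP a b : (forall A, coord a A = coord b A) <-> a = b.
Proof.
split=> [h|-> //].
by apply: (proj1 (@ffunP _ (fun=> R^o) a b)) => A; apply: h.
Qed.

Lemma coordD a b A : coord (a + b) A = coord a A + coord b A.
Proof. by rewrite /coord ffunE. Qed.

Lemma coordZ k a A : coord (k *: a) A = k * coord a A.
Proof. by rewrite /coord ffunE. Qed.

Lemma coord0 A : coord 0 A = 0.
Proof. by rewrite /coord ffunE. Qed.

Lemma coord_sum I (r : seq I) (P : pred I) (F : I -> Cl) A :
  coord (\sum_(i <- r | P i) F i) A = \sum_(i <- r | P i) coord (F i) A.
Proof.
exact: (big_morph (fun a => coord a A) (fun x y => coordD x y A) (coord0 A)).
Qed.

Lemma coord_basis A B : coord (basis A) B = (B == A)%:R.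
Proof. by rewrite /coord ffunE. Qed.

Lemma cl_decomp a : a = \sum_A coord a A *: basis A.
Proof.
apply/clP => A; rewrite coord_sum (bigD1 A) //= big1 => [|B BA].
  by rewrite coordZ coord_basis eqxx mulr1 addr0.
by rewrite coordZ coord_basis eq_sym (negPf BA) mulr0.
Qed.

Lemma clmulDl : left_distributive clmul +%R.
Proof.
move=> a b c; rewrite /clmul -big_split /=; apply: eq_bigr => A _.
rewrite -big_split /=; apply: eq_bigr => B _.
by rewrite -scalerDl coordD !mulrDl.
Qed.

Lemma clmulDr : right_distributive clmul +%R.
Proof.
move=> a b c; rewrite /clmul -big_split /=; apply: eq_bigr => A _.
rewrite -big_split /=; apply: eq_bigr => B _.
by rewrite -scalerDl coordD mulrDr !mulrDl.
Qed.

Lemma clmulZl k a b : clmul (k *: a) b = k *: clmul a b.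
Proof.
rewrite /clmul scaler_sumr; apply: eq_bigr => A _.
rewrite scaler_sumr; apply: eq_bigr => B _.
by rewrite coordZ scalerA !mulrA.
Qed.

Lemma clmulZr k a b : clmul a (k *: b) = k *: clmul a b.
Proof.
rewrite /clmul scaler_sumr; apply: eq_bigr => A _.
rewrite scaler_sumr; apply: eq_bigr => B _.
by rewrite coordZ scalerA !mulrA [k * _]mulrC.
Qed.

Lemma clmul0l b : clmul 0 b = 0.
Proof. by have := clmulZl 0 0 b; rewrite !scale0r. Qed.

Lemma clmul0r b : clmul b 0 = 0.
Proof. by have := clmulZr 0 b 0; rewrite !scale0r. Qed.

Lemma clmul_suml I (r : seq I) (P : pred I) (F : I -> Cl) b :
  clmul (\sum_(i <- r | P i) F i) b = \sum_(i <- r | P i) clmul (F i) b.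
Proof.
exact: (big_morph (clmul^~ b) (fun x y => clmulDl x y b) (clmul0l b)).
Qed.

Lemma clmul_sumr I (r : seq I) (P : pred I) (F : I -> Cl) b :
  clmul b (\sum_(i <- r | P i) F i) = \sum_(i <- r | P i) clmul b (F i).
Proof.
exact: (big_morph (clmul b) (fun x y => clmulDr b x y) (clmul0r b)).
Qed.

Lemma clmul_basis A B :
  clmul (basis A) (basis B) = (-1) ^+ swaps A B *: basis (symdiff A B).
Proof.
rewrite /clmul (bigD1 A) //= [X in _ + X]big1 ?addr0 => [|C CA].
  rewrite (bigD1 B) //= big1 ?addr0 => [|C CB].
    by rewrite !coord_basis !eqxx !mul1r.
  by rewrite !coord_basis (negPf CB) mulr0 mul0r scale0r.
by rewrite big1 // => D _; rewrite !coord_basis (negPf CA) !mul0r scale0r.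
Qed.

Lemma odd_swaps A B : odd (swaps A B) =
  \big[addb/false]_i \big[addb/false]_j
     [&& i \in A, j \in B & (j <= i)%N].
Proof.
rewrite /swaps (big_morph odd oddD (erefl _)) big_mkcond; apply: eq_bigr => i _.
case: (i \in A) => /=; last by rewrite big1.
rewrite -sum1_card (big_morph odd oddD (erefl _)) big_mkcond.
by apply: eq_bigr => j _; rewrite inE; case: ifP.
Qed.

Lemma odd_swapsDl A B C :
  odd (swaps (symdiff A B) C) = odd (swaps A C) (+) odd (swaps B C).
Proof.
rewrite !odd_swaps -big_split; apply: eq_bigr => i _.
rewrite -big_split; apply: eq_bigr => j _ /=; rewrite inE.
by case: (i \in A); case: (i \in B); case: (j \in C); case: (j <= i)%N.
Qed.

Lemma odd_swapsDr A B C :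
  odd (swaps C (symdiff A B)) = odd (swaps C A) (+) odd (swaps C B).
Proof.
rewrite !odd_swaps -big_split; apply: eq_bigr => i _.
rewrite -big_split; apply: eq_bigr => j _ /=; rewrite inE.
by case: (j \in A); case: (j \in B); case: (i \in C); case: (j <= i)%N.
Qed.

Lemma symdiffA : associative (@symdiff n).
Proof. by move=> A B C; apply/setP => i; rewrite !inE addbA. Qed.

Lemma clmulA : associative clmul.
Proof.
move=> a b c.
rewrite (cl_decomp a) [LHS]clmul_suml.
rewrite [X in _ = clmul X c]clmul_suml [RHS]clmul_suml; apply: eq_bigr => A _.
rewrite [LHS]clmulZl [X in _ = clmul X c]clmulZl [RHS]clmulZl; congr (_ *: _).
rewrite (cl_decomp b) [X in clmul _ X = _]clmul_suml [LHS]clmul_sumr.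
rewrite [X in _ = clmul X c]clmul_sumr [RHS]clmul_suml; apply: eq_bigr => B _.
rewrite [X in clmul _ X = _]clmulZl [LHS]clmulZr.
rewrite [X in _ = clmul X c]clmulZr [RHS]clmulZl; congr (_ *: _).
rewrite (cl_decomp c) [X in clmul _ X = _]clmul_sumr [LHS]clmul_sumr.
rewrite [RHS]clmul_sumr; apply: eq_bigr => C _.
rewrite [X in clmul _ X = _]clmulZr [LHS]clmulZr [RHS]clmulZr; congr (_ *: _).
rewrite !clmul_basis clmulZl clmulZr !clmul_basis !scalerA symdiffA.
congr (_ *: _); rewrite -!exprD -[LHS]signr_odd -[RHS]signr_odd !oddD.
rewrite odd_swapsDl odd_swapsDr; congr (_ ^+ nat_of_bool _).
by rewrite addbC -addbA.
Qed.

Lemma clmul1l : left_id (basis finset.set0) clmul.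
Proof.
move=> a; rewrite [in RHS](cl_decomp a) [in LHS](cl_decomp a) clmul_sumr.
apply: eq_bigr => A _; rewrite clmulZr clmul_basis; congr (_ *: _).
rewrite /swaps big_set0 expr0 scale1r; congr basis.
by apply/setP => i; rewrite !inE.
Qed.

Lemma clmul1r : right_id (basis finset.set0) clmul.
Proof.
move=> a; rewrite [in RHS](cl_decomp a) [in LHS](cl_decomp a) clmul_suml.
apply: eq_bigr => A _; rewrite clmulZl clmul_basis; congr (_ *: _).
rewrite /swaps big1 => [|i _]; last first.
  by apply/eqP; rewrite cards_eq0; apply/eqP/setP => j; rewrite !inE.
rewrite expr0 scale1r; congr basis.
by apply/setP => i; rewrite !inE addbF.
Qed.

Lemma cl1_neq0 : basis finset.set0 != 0 :> Cl.
Proof.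
apply/eqP => /clP /(_ finset.set0) /eqP.
by rewrite coord_basis coord0 eqxx oner_eq0.
Qed.

HB.instance Definition _ := GRing.Zmodule_isNzRing.Build Cl
  clmulA clmul1l clmul1r clmulDl clmulDr cl1_neq0.
HB.instance Definition _ := GRing.Lmodule_isLalgebra.Build R Cl
  (fun k a b => esym (clmulZl k a b)).
HB.instance Definition _ := GRing.Lalgebra_isAlgebra.Build R Cl
  (fun k a b => esym (clmulZr k a b)).

Lemma basis0 : basis finset.set0 = 1.
Proof. by []. Qed.

Lemma basisM A B :
  basis A * basis B = (-1) ^+ swaps A B *: basis (symdiff A B).
Proof. exact: clmul_basis. Qed.

Lemma genM (i j : 'I_n) : gen i * gen j + gen j * gen i = - 2 * (i == j)%:R.
Proof.
rewrite !basisM.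
have -> : symdiff [set j] [set i] = symdiff [set i] [set j].
  by apply/setP => k; rewrite !inE addbC.
rewrite -scalerDl /swaps !big_set1.
have card_le (k l : 'I_n) :
    #|[set m in [set l]%SET | (m <= k)%N]%SET| = (l <= k)%N.
  case: (leqP l k) => lk /=.
    rewrite -(cards1 l); apply: eq_card => m; rewrite !inE.
    by case: eqP => //= ->.
  apply/eqP; rewrite cards_eq0; apply/eqP/setP => m; rewrite !inE.
  by case: eqP => //= ->; rewrite leqNgt lk.
rewrite !card_le; case: eqVneq => [->|ij].
  rewrite leqnn expr1 mulr1 -opprD scaleNr.
  have -> : symdiff [set j]%SET [set j]%SET = finset.set0.
    by apply/setP => k; rewrite !inE addbb.
  by rewrite scalerDl scale1r.
rewrite mulr0; case: (ltngtP i j) => [h|h|/val_inj h] /=.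
- by rewrite subrr scale0r.
- by rewrite addNr scale0r.
- by rewrite h eqxx in ij.
Qed.

(* enum A lists A in increasing order. *)
Lemma basisE A : basis A = \prod_(i <- enum A) gen i.
Proof.
have enum_sorted : sorted (fun i j : 'I_n => (i < j)%N) (enum A).
  rewrite {1}/enum_mem -enumT; apply: sorted_filter.
    by move=> i j k; apply: ltn_trans.
  by have := iota_ltn_sorted 0 n; rewrite -val_enum_ord sorted_map.
have -> : basis A = basis [set i in enum A]%SET.
  by congr basis; apply/setP => i; rewrite inE mem_enum.
elim: (enum A) enum_sorted => [_|i s IHs /= is_sorted].
  by rewrite big_nil -basis0; congr basis; apply/setP => i; rewrite !inE.
rewrite big_cons -IHs ?(path_sorted is_sorted) //.
have /allP i_min : all (fun j : 'I_n => (i < j)%N) s.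
  by apply: order_path_min is_sorted => j k l; apply: ltn_trans.
rewrite basisM /swaps big_set1.
have -> : #|[set j in [set j in s]%SET | (j <= i)%N]%SET| = 0%N.
  apply/eqP; rewrite cards_eq0; apply/eqP/setP => j; rewrite !inE.
  by case: (boolP (j \in s)) => //= /i_min; rewrite ltnNge => /negPf.
rewrite expr0 scale1r; congr basis; apply/setP => j; rewrite !inE.
case: eqVneq => //= ->; case: (boolP (i \in s)) => //= /i_min.
by rewrite ltnn.
Qed.

End Clifford.

Section Paravectors.
Variables (R : realType) (n : nat).
Implicit Types s : 'rV[R]_n.+1.

Definition repart s : R := s 0 ord0.

Definition vecpart s : clifford R n := \sum_(j < n) s 0 (lift ord0 j) *: gen R j.

Definition para s : clifford R n := (repart s)%:A + vecpart s.

Definition paraconj s : clifford R n := (repart s)%:A - vecpart s.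

(* Not the norm `|s| of the library on row vectors, which is the sup norm. *)
Definition euclid s : R := Num.sqrt (\sum_(i < n.+1) s 0 i ^+ 2).

End Paravectors.

Section Operators.
Local Open Scope classical_set_scope.
Variables (R : realType) (V : completeNormedModType R) (n : nat).

(* V (x) R_n: v is its family of coordinates (v_A), i.e., v = \sum_A v_A e_A. *)
Definition tensor : Type := {ffun {set 'I_n} -> V}.

HB.instance Definition _ := GRing.Lmodule.copy tensor {ffun {set 'I_n} -> V}.

Implicit Types (v : tensor) (T Q : tensor -> tensor).

Definition tcoord v (A : {set 'I_n}) : V := (v : {ffun {set 'I_n} -> V}) A.

Definition pure (w : V) (a : clifford R n) : tensor :=
  ([ffun A => coord a A *: w] : {ffun {set 'I_n} -> V}).

Definition lmult (a : clifford R n) v : tensor :=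
  \sum_A pure (tcoord v A) (a * basis R A).

Definition bounded_op (f : V -> V) : Prop :=
  linear f /\ exists M : R, forall x : V, `|f x| <= M * `|x|.

Definition act (F : {set 'I_n} -> V -> V) : tensor -> tensor :=
  fun v => \sum_A \sum_B pure (F A (tcoord v B)) (basis R A * basis R B).

(* The operators \sum_A F_A e_A.  The family F is determined by the map act F
   (act_inj), so that operators can be taken to be maps on V (x) R_n, their
   product being the composition. *)
Definition Bn : set (tensor -> tensor) :=
  [set T | exists2 F, (forall A, bounded_op (F A)) & T = act F].

Definition extend (f : V -> V) : tensor -> tensor :=
  fun v => \sum_A pure (f (tcoord v A)) (basis R A).

(* The operators T_0 + \sum_j e_j T_j. *)
Definition B01n : set (tensor -> tensor) :=
  [set T | exists T0 : V -> V, exists Tj : 'I_n -> V -> V,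
     [/\ bounded_op T0, forall j, bounded_op (Tj j) &
         T = extend T0 \+ (fun v => \sum_(j < n) lmult (gen R j) (extend (Tj j) v))]].

Definition is_inverse T T' : Prop :=
  [/\ Bn T', T \o T' = idfun & T' \o T = idfun].

Definition invertible T : Prop := exists T', is_inverse T T'.

(* Inverse in Bn; T itself when T is not invertible. *)
Definition opinv T : tensor -> tensor := xget T [set T' | is_inverse T T'].

Definition Qs (s : 'rV[R]_n.+1) T : tensor -> tensor :=
  (T \o T) \- (2 * repart s) \*: T \+ (euclid s ^+ 2) \*: idfun.

Definition S_spectrum T : set 'rV[R]_n.+1 := [set s | ~ invertible (Qs s T)].

Definition S_resolvent_set T : set 'rV[R]_n.+1 := ~` S_spectrum T.

Definition S_resolvent (s : 'rV[R]_n.+1) T : tensor -> tensor :=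
  \- (opinv (Qs s T) \o (T \- lmult (paraconj s))).

Lemma tcoordD u v A : tcoord (u + v) A = tcoord u A + tcoord v A.
Proof. by rewrite /tcoord ffunE. Qed.

Lemma tcoord0 A : tcoord 0 A = 0.
Proof. by rewrite /tcoord ffunE. Qed.

Lemma tcoord_sum I (r : seq I) (P : pred I) (F : I -> tensor) A :
  tcoord (\sum_(i <- r | P i) F i) A = \sum_(i <- r | P i) tcoord (F i) A.
Proof.
exact: (big_morph (fun a => tcoord a A) (fun x y => tcoordD x y A) (tcoord0 A)).
Qed.

Lemma tcoord_pure w a A : tcoord (pure w a) A = coord a A *: w.
Proof. by rewrite /tcoord ffunE. Qed.

Lemma tensorP u v : (forall A, tcoord u A = tcoord v A) <-> u = v.
Proof.
split=> [h|-> //].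
by apply: (proj1 (@ffunP _ (fun=> V) u v)) => A; apply: h.
Qed.

Lemma opinvP T : invertible T -> is_inverse T (opinv T).
Proof. by move=> [T' T'P]; apply: (@xgetPex _ T [set T' | is_inverse T T']); exists T'. Qed.

Lemma bounded_op0 : bounded_op (fun=> 0).
Proof.
split=> [k x y|]; first by rewrite scaler0 addr0.
by exists 0 => x; rewrite normr0 mul0r.
Qed.

Lemma bounded_op_at0 f : bounded_op f -> f 0 = 0.
Proof.
by move=> [f_lin _]; have := f_lin (-1) 0 0; rewrite scaleN1r addNr scaleN1r addNr.
Qed.

Lemma act_pure F w : (forall A, F A 0 = 0) ->
  forall A, tcoord (act F (pure w 1)) A = F A w.
Proof.
move=> F0 A; rewrite tcoord_sum (bigD1 A) //= [X in _ + X]big1 => [|B BA].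
  rewrite tcoord_sum (bigD1 finset.set0) //= big1 => [|B B0].
    by rewrite !tcoord_pure basis0 mulr1 !coord_basis !eqxx !scale1r !addr0.
  by rewrite !tcoord_pure coord_basis (negPf B0) scale0r F0 scaler0.
rewrite tcoord_sum big1 // => C _; rewrite !tcoord_pure coord_basis.
case: eqVneq => [->|_]; last by rewrite scale0r F0 scaler0.
by rewrite basis0 mulr1 coord_basis eq_sym (negPf BA) scale0r.
Qed.

Lemma act_inj F G : (forall A, bounded_op (F A)) ->
  (forall A, bounded_op (G A)) -> act F = act G -> F = G.
Proof.
move=> Fb Gb FG; apply/funext => A; apply/funext => w.
rewrite -(act_pure w (fun A => bounded_op_at0 (Fb A))) FG act_pure // => B.
exact: bounded_op_at0.
Qed.

Lemma extendE f v A : f 0 = 0 -> tcoord (extend f v) A = f (tcoord v A).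
Proof.
move=> f0; rewrite tcoord_sum (bigD1 A) //= big1 => [|B BA].
  by rewrite tcoord_pure coord_basis eqxx scale1r addr0.
by rewrite tcoord_pure coord_basis eq_sym (negPf BA) scale0r.
Qed.

Lemma B01n_sub : B01n `<=` Bn.
Proof.
move=> _ [T0 [Tj [T0b Tjb ->]]].
pose F A : V -> V := if A == finset.set0 then T0 else
  if [pick j | A == [set j]%SET] is Some j then Tj j else fun=> 0.
exists F => [A|].
  rewrite /F; case: eqP => // _; case: pickP => // _; exact: bounded_op0.
apply/funext => v.
rewrite /act (bigD1 finset.set0) //= /F eqxx; congr (_ + _).
  by apply: eq_bigr => A _; rewrite basis0 mul1r.
have pick_set1 j : [pick k | [set j]%SET == [set k]%SET :> {set 'I_n}] = Some j.
  case: pickP => [k /eqP/setP/(_ k)|/(_ j)]; last by rewrite eqxx.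
  by rewrite !inE eqxx => /eqP ->.
have sum_set1 (G : {set 'I_n} -> tensor) :
    (forall A, A != finset.set0 -> (forall j, A != [set j]%SET) -> G A = 0) ->
    \sum_(A | A != finset.set0) G A = \sum_(j < n) G [set j]%SET.
  move=> G0.
  rewrite (bigID (fun A => A \in [set [set j]%SET | j : 'I_n]%SET)) /=.
  rewrite [X in _ + X]big1 ?addr0 => [|A /andP[A0 /imsetP nA]].
    rewrite (eq_bigl (fun A => A \in [set [set j]%SET | j : 'I_n]%SET)) => [|A].
      by rewrite big_imset //= => i j _ _; apply: finset.set1_inj.
    rewrite andbC; case: imsetP => //= -[j _ ->].
    by rewrite -cards_eq0 cards1.
  apply: G0 => // j; apply/eqP => Aj; apply: nA; by exists j.
rewrite sum_set1 => [|A A0 A1]; last first.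
  rewrite (negPf A0); case: pickP => [j|_]; first by rewrite (negPf (A1 j)).
  apply: big1 => B _; apply/tensorP => C.
  by rewrite tcoord_pure tcoord0 scaler0.
apply: eq_bigr => j _; rewrite pick_set1.
have -> : ([set j]%SET == finset.set0 :> {set 'I_n}) = false.
  by rewrite -cards_eq0 cards1.
by apply: eq_bigr => A _; rewrite extendE // bounded_op_at0.
Qed.

End Operators.

(* Main.v *)
Require Import Defs.
From HB Require Import structures.
From mathcomp Require Import all_boot all_order all_algebra.
From mathcomp Require Import all_classical all_reals all_analysis.

Import GRing.Theory Num.Theory.
Import numFieldNormedType.Exports.
Local Open Scope ring_scope.

(** Write [Q] for [T^2 - 2 Re(s) T + |s|^2].  Its coefficients are real, hence
    central, so [T] commutes with [Q] and therefore with [Q^-1], although [T]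
    need not commute with [s] nor its components with one another.  This gives
    [S^-1 s - T S^-1 = Q^-1 (- (T - s~) s + T (T - s~))
                     = Q^-1 (T^2 - T (s + s~) + s~ s)],
    where [s~] is the conjugate of [s].  Now [s + s~ = 2 Re(s)] and
    [s~ s = |s|^2] are real ([paraDconj], [paraconjM]), so the last factor is
    [Q] itself.  Reading products with paravectors as compositions of operators
    requires left multiplication to be an action of the Clifford algebra
    ([lmultM]); moving real scalars through [T] and factoring [Q^-1] out of a
    difference rest on the linearity of both ([Bn_linear]). *)

Section ParavectorNorm.
Context {R : realType} {n : nat}.
Implicit Type s : 'rV[R]_n.+1.

(** Symmetrising the double sum turns the products of two units into their
    anticommutators, which vanish off the diagonal; the factor 2 this costs is
    cancelled at the end. *)
Lemma vecpart_sqr s :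
  vecpart s * vecpart s = - (\sum_(j < n) s 0 (lift ord0 j) ^+ 2)%:A.
Proof.
have two_neq0 : (2 : R) != 0 by rewrite pnatr_eq0.
pose x j := s 0 (lift ord0 j).
have -> : vecpart s * vecpart s =
    \sum_i \sum_j (x i * x j) *: (gen R i * gen R j).
  rewrite mulr_suml; apply: eq_bigr => i _; rewrite mulr_sumr.
  by apply: eq_bigr => j _; rewrite -scalerAl -scalerAr scalerA.
apply: (scalerI two_neq0); rewrite [LHS]scaler_nat mulr2n.
rewrite [X in _ + X]exchange_big -big_split /= scaler_suml -sumrN scaler_sumr.
apply: eq_bigr => i _; rewrite -big_split (bigD1 i) //= big1 => [|j ji].
  rewrite addr0 -scalerDr genM eqxx mulr1 -expr2 scalerN.
  by rewrite [RHS]scalerN [in RHS]scalerA mulrC -[in RHS]scalerA scaler_nat.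
rewrite [X in _ + X *: _]mulrC -scalerDr genM.
by rewrite eq_sym (negPf ji) mulr0 scaler0.
Qed.

Lemma paraDconj s : para s + paraconj s = (2 * repart s)%:A.
Proof. by rewrite addrACA subrr addr0 -scalerDl -mulr2n mulr_natl. Qed.

Lemma paraconjM s : paraconj s * para s = (euclid s ^+ 2)%:A.
Proof.
rewrite /euclid sqr_sqrtr; last by apply: sumr_ge0 => i _; apply: sqr_ge0.
rewrite /para /paraconj mulrBl !mulrDr vecpart_sqr.
rewrite -!scalerAl -!scalerAr !mul1r mulr1 scalerA -expr2.
by rewrite opprD opprK addrA addrK -scalerDl big_ord_recl.
Qed.

End ParavectorNorm.

Section LeftMultiplication.
Context {R : realType} {V : completeNormedModType R} {n : nat}.
Implicit Types (v w : tensor V n) (a b c : clifford R n) (x : V) (k : R).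

Lemma tcoordZ k v A : tcoord (k *: v) A = k *: tcoord v A.
Proof. by rewrite /tcoord ffunE. Qed.

Lemma pure_linearl a : linear (fun x : V => pure x a).
Proof.
move=> k x y; apply/tensorP => A.
by rewrite tcoordD tcoordZ !tcoord_pure scalerDr !scalerA mulrC.
Qed.

Lemma pureZl k x a : pure (k *: x) a = k *: pure x a.
Proof.
by apply/tensorP => A; rewrite tcoordZ !tcoord_pure !scalerA mulrC.
Qed.

Lemma pure_linearr x : linear (fun a : clifford R n => pure x a).
Proof.
move=> k a b; apply/tensorP => A.
by rewrite tcoordD tcoordZ !tcoord_pure coordD coordZ scalerDl scalerA.
Qed.

HB.instance Definition _ x :=
  GRing.isLinear.Build R (clifford R n) (tensor V n) _ (pure x)
    (pure_linearr x).

Lemma tensor_decomp v : v = \sum_A pure (tcoord v A) (Defs.basis R A).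
Proof.
apply/tensorP => A; rewrite tcoord_sum (bigD1 A) //= big1 => [|B BA].
  by rewrite tcoord_pure Defs.coord_basis eqxx scale1r addr0.
by rewrite tcoord_pure Defs.coord_basis eq_sym (negPf BA) scale0r.
Qed.

Lemma lmult_linear a : linear (@lmult R V n a).
Proof.
move=> k v w; rewrite /lmult scaler_sumr -big_split; apply: eq_bigr => A _.
by rewrite tcoordD tcoordZ pure_linearl.
Qed.

HB.instance Definition _ a :=
  GRing.isLinear.Build R (tensor V n) (tensor V n) _ (lmult a) (lmult_linear a).

Lemma lmultDl a b v : lmult (a + b) v = lmult a v + lmult b v.
Proof.
by rewrite /lmult -big_split; apply: eq_bigr => A _; rewrite mulrDl raddfD.
Qed.

Lemma lmult_scalar k v : lmult k%:A v = k *: v.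
Proof.
rewrite {2}(tensor_decomp v) scaler_sumr; apply: eq_bigr => A _.
by rewrite -scalerAl mul1r linearZ.
Qed.

Lemma lmult_pure a x c : lmult a (pure x c) = pure x (a * c).
Proof.
rewrite {2}(cl_decomp c) mulr_sumr linear_sum; apply: eq_bigr => A _.
by rewrite tcoord_pure pureZl -scalerAr linearZ.
Qed.

(** Every tensor is a sum of pure ones, on which the claim is the associativity
    of the Clifford product. *)
Lemma lmultM a b v : lmult a (lmult b v) = lmult (a * b) v.
Proof.
rewrite [lmult b v]/lmult [LHS]linear_sum.
by apply: eq_bigr => A _; rewrite [LHS]lmult_pure mulrA.
Qed.

Lemma Bn_linear (T : tensor V n -> tensor V n) : Bn T -> linear T.
Proof.
move=> [F Fb ->] k v w; rewrite /act scaler_sumr -big_split.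
apply: eq_bigr => A _; rewrite scaler_sumr -big_split; apply: eq_bigr => B _.
by rewrite tcoordD tcoordZ (proj1 (Fb A)) pure_linearl.
Qed.

End LeftMultiplication.

Section ResolventEquation.
Context {R : realType} {V : completeNormedModType R} {n : nat}.

Lemma Qs_comm (T : {linear tensor V n -> tensor V n}) (s : 'rV[R]_n.+1) v :
  T (Qs s T v) = Qs s T (T v).
Proof. by rewrite /Qs /= linearD linearB !linearZ. Qed.

(** What remains of the resolvent equation once [Q^-1] is pulled out on the
    left.  In every product [T] stays to the left of the paravectors, so that
    only the sum and the product of [s] and its conjugate enter. *)
Lemma Qs_factor (T : {linear tensor V n -> tensor V n}) (s : 'rV[R]_n.+1) v :
  T (T v - lmult (paraconj s) v)
    - (T (lmult (para s) v) - lmult (paraconj s) (lmult (para s) v))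
  = Qs s T v.
Proof.
have trace_term : T (lmult (para s) v) + T (lmult (paraconj s) v) =
    (2 * repart s) *: T v.
  by rewrite -linearD -lmultDl paraDconj lmult_scalar linearZ.
rewrite lmultM paraconjM lmult_scalar linearB opprB.
rewrite [_ - T (lmult (para s) v)]addrC.
by rewrite /Qs /= -trace_term [T (lmult (para s) v) + _]addrC opprD !addrA.
Qed.

End ResolventEquation.

Theorem theorem3p7 (R : realType) (V : completeNormedModType R) (n : nat)
  (T : tensor V n -> tensor V n) (s : 'rV[R]_n.+1)
  (hT : B01n T) (hs : S_resolvent_set T s) :
  (S_resolvent s T \o lmult (para s)) \- (T \o S_resolvent s T) = idfun.
Proof.
pose lT := GRing.isLinear.Build R _ _ _ T (Bn_linear _ (B01n_sub hT)).
pose LT : {linear tensor V n -> tensor V n} := HB.pack T lT.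
have /opinvP[] : invertible (Qs s T) by apply: contrapT.
rewrite /S_resolvent; set Q := Qs s T; set Q' := opinv Q => Q'Bn QQ' Q'Q.
pose lQ' := GRing.isLinear.Build R _ _ _ Q' (Bn_linear _ Q'Bn).
pose LQ' : {linear tensor V n -> tensor V n} := HB.pack Q' lQ'.
have QK : cancel Q Q' := fun v => congr1 (@^~ v) Q'Q.
have Q'K : cancel Q' Q := fun v => congr1 (@^~ v) QQ'.
have TQ v : T (Q v) = Q (T v) := Qs_comm LT s v.
have TQ' v : T (Q' v) = Q' (T v).
  by apply: (can_inj QK); rewrite Q'K -TQ Q'K.
apply/funext => v /=.
rewrite -[RHS]QK -[Q v](Qs_factor LT) [RHS](raddfB LQ') /=.
by rewrite -TQ' -[T (- _)]/(LT (- _)) raddfN /= opprK addrC.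
Qed.
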